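(* Let $G$ be a finite graph with no loop, no multiple edge and no isolated vertex on the vertex set $V(G)=\{x_1,\ldots,x_n\}$. Then there is a vector $\mathfrak{c}\in\mathbb{N}^n$ for which the toric ring $\mathcal{B}(\mathfrak{c},G)$ is Gorenstein.
   Context: $\mathbb{N}$ denotes the set of positive integers, $K$ is a field and $S=K[x_1,\ldots,x_n]$ is the polynomial ring. For a monomial ideal $I\subset S$ and $\mathfrak{c}=(c_1,\ldots,c_n)\in\mathbb{N}^n$, $I_{\mathfrak{c}}$ is the ideal generated by those monomials $x_1^{a_1}\cdots x_n^{a_n}\in I$ with $a_i\le c_i$ for all $i$; $\delta_{\mathfrak{c}}(I)$ is the largest integer $q$ for which $(I^q)_{\mathfrak{c}}\neq 0$. For a finite graph $G$ on $\{x_1,\ldots,x_n\}$ (no loop, no multiple edge, no isolated vertex), its edge ideal $I(G)\subset S$ is generated by the monomials $x_ix_j$ with $\{x_i,x_j\}\in E(G)$. If $\{w_1,\ldots,w_s\}$ is the minimal set of monomial generators of $(I(G)^{\delta})_{\mathfrak{c}}$ with $\delta=\delta_{\mathfrak{c}}(I(G))$, then $\mathcal{B}(\mathfrak{c},G):=K[w_1,\ldots,w_s]\subset S$. *)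

(* Defs.v *)
From HB Require Import structures.
From mathcomp Require Import all_boot all_order all_algebra.
From mathcomp Require Import boolp classical_sets.
From mathcomp Require Import mpoly.

Set Implicit Arguments.
Unset Strict Implicit.
Unset Printing Implicit Defensive.

Import GRing.Theory.

Local Open Scope ring_scope.
Local Open Scope classical_set_scope.

(* Ideals are Prop-valued sets and may be improper, unlike the decidable proper
   ideals [idealr] of ring_quotient. *)
Section Ideals.
Variable R : comNzRingType.
Implicit Types (I J A : set R).

Definition is_ideal I : Prop :=
  [/\ I 0, forall x y, I x -> I y -> I (x + y) & forall a x, I x -> I (a * x)].

Definition ideal_span A : set R :=
  [set x | forall J, is_ideal J -> A `<=` J -> J x].

(* The empty product gives [ideal_pow I 0 = setT]. *)
Definition ideal_pow I (q : nat) : set R :=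
  ideal_span [set x | exists f : 'I_q -> R,
                        (forall i, I (f i)) /\ x = \prod_(i < q) f i].

Definition maximal_ideal I : Prop :=
  [/\ is_ideal I, ~ I 1 &
      forall J, is_ideal J -> ~ J 1 -> I `<=` J -> J `<=` I].

Definition noetherian : Prop :=
  forall I, is_ideal I -> exists s : seq R, I = ideal_span [set x | x \in s].

End Ideals.

(* [f] exhibits [L] as the localization of [R] at the prime ideal [P]; such an
   [L] is unique up to a unique isomorphism over [R]. *)
Definition is_localization_at (R : comNzRingType) (P : set R)
    (L : comNzRingType) (f : {rmorphism R -> L}) : Prop :=
  [/\ forall s, ~ P s -> exists u, f s * u = 1,
      forall y, exists a s, ~ P s /\ y * f s = f a &
      forall a, f a = 0 -> exists2 s, ~ P s & s * a = 0].

Definition injective_module (R : comNzRingType) (E : lmodType R) : Prop :=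
  forall (A B : lmodType R) (i : {linear A -> B}) (g : {linear A -> E}),
    injective i -> exists h : {linear B -> E}, forall x, h (i x) = g x.

(* M has an injective resolution 0 -> M -> E 0 -> E 1 -> ... with E k = 0 for
   all k > d. *)
Definition injdim_le (R : comNzRingType) (M : lmodType R) (d : nat) : Prop :=
  exists (E : nat -> lmodType R) (eta : {linear M -> E 0%N})
         (del : forall k, {linear E k -> E k.+1}),
    [/\ forall k, injective_module (E k),
        injective eta,
        forall y, del 0%N y = 0 <-> exists x, eta x = y,
        forall k y, del k.+1 y = 0 <-> exists x, del k x = y &
        forall k, (d < k)%N -> forall y : E k, y = 0].

(* Bruns-Herzog, Definition 3.1.18: a Noetherian ring all of whose localizations
   at maximal ideals have finite injective dimension over themselves. *)
Definition gorenstein (R : comNzRingType) : Prop :=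
  noetherian R /\
  forall P : set R, maximal_ideal P ->
    exists (L : comNzRingType) (f : {rmorphism R -> L}),
      is_localization_at P f /\ exists d, injdim_le L^o d.

Section MonomialIdeals.
Variables (K : fieldType) (n : nat).
Implicit Types (c : 'X_{1..n}) (I J : set {mpoly K[n]}) (w : seq 'X_{1..n}).

Definition monomial_span w : set {mpoly K[n]} :=
  ideal_span [set p | exists2 m, m \in w & p = 'X_[m]].

Definition bounded_part c I : set {mpoly K[n]} :=
  ideal_span [set p | exists m, [/\ I 'X_[m], (m <= c)%MM & p = 'X_[m]]].

Definition is_delta c I (q : nat) : Prop :=
  let nz r := exists2 p, bounded_part c (ideal_pow I r) p & p != 0 in
  nz q /\ forall r, nz r -> (r <= q)%N.

(* 0 if there is no largest exponent, which cannot happen for edge ideals: there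
   a bounded monomial of I^q has degree between 2q and the degree of c. *)
Definition delta c I : nat := xget 0%N [set q | is_delta c I q].

Definition is_min_mongens J w : Prop :=
  [/\ uniq w, monomial_span w = J &
      forall w', {subset w' <= w} -> monomial_span w' = J -> {subset w <= w'}].

(* Determined up to order when J is a monomial ideal. *)
Definition min_mongens J : seq 'X_{1..n} := xget [::] [set w | is_min_mongens J w].

End MonomialIdeals.

Section MonomialSubalgebra.
Variables (K : fieldType) (n : nat) (w : seq 'X_{1..n}).

Definition monomial_tuple : (size w).-tuple {mpoly K[n]} :=
  map_tuple (fun m => 'X_[m]) (in_tuple w).

Definition monomial_subalg : {pred {mpoly K[n]}} :=
  fun p => `[< exists P : {mpoly K[size w]}, p = P \mPo monomial_tuple >].

Fact monomial_subalg_closed : subring_closed monomial_subalg.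
Proof.
split=> [|p q /asboolP[P ->] /asboolP[Q ->]|p q /asboolP[P ->] /asboolP[Q ->]].
- by apply/asboolP; exists 1; rewrite rmorph1.
- by apply/asboolP; exists (P - Q); rewrite rmorphB.
- by apply/asboolP; exists (P * Q); rewrite rmorphM.
Qed.

HB.instance Definition _ :=
  GRing.isSubringClosed.Build {mpoly K[n]} monomial_subalg monomial_subalg_closed.

Record monomial_ring : Type := MonomialRing {
  monomial_ring_val :> {mpoly K[n]};
  _ : monomial_ring_val \in monomial_subalg }.

HB.instance Definition _ := [isSub for monomial_ring_val].
HB.instance Definition _ := [Choice of monomial_ring by <:].
HB.instance Definition _ := [SubChoice_isSubComNzRing of monomial_ring by <:].

End MonomialSubalgebra.

Section ToricRing.
Variables (K : fieldType) (n : nat).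

(* Simple graphs on {x_1, ..., x_n} are given by their adjacency relation. *)
Definition simple_graph (e : rel 'I_n) : Prop := ssrbool.symmetric e /\ irreflexive e.

Definition no_isolated_vertex (e : rel 'I_n) : Prop := forall i, exists j, e i j.

Definition edge_ideal (e : rel 'I_n) : set {mpoly K[n]} :=
  ideal_span [set p | exists i j, e i j /\ p = 'X_i * 'X_j].

Definition toric_ring (c : 'X_{1..n}) (e : rel 'I_n) : comNzRingType :=
  let I := edge_ideal e in
  monomial_ring K (min_mongens (bounded_part c (ideal_pow I (delta c I)))).

End ToricRing.

(* Main.v *)
From HB Require Import structures.
From mathcomp Require Import all_boot all_order all_algebra.
From mathcomp Require Import boolp classical_sets.
From mathcomp Require Import mpoly.
Require Import Defs.

(** Since the vector c may be chosen, it can be chosen so that the toric ring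
    has a single generator.  Pick a neighbour s i of every vertex i and let
    c be the exponent of the product, over all i, of the edges x_i x_(s i).
    This monomial X^c is a product of n edges of total degree 2n, so it lies in
    I(G)^n.  A monomial of I(G)^q has degree at least 2q, while a c-bounded
    monomial has degree at most 2n, with equality only for X^c itself.  Hence
    delta_c(I(G)) = n and (I(G)^n)_c is generated by X^c alone
    ([matched_delta], [matched_bounded_part]), and every c_i is positive because
    x_i divides the edge chosen at i.  The toric ring is K[X^c]: a polynomial
    ring in one variable, or K when n = 0.

    Both cases are covered at once by two facts: K[X^c] is a quotient of the
    polynomial ring K[t], so its ideals are principal, and it embeds in a field,
    so it is a domain.  It remains to see that such a ring R is Gorenstein
    ([gorenstein_pid]).  A localization L of R at a maximal ideal is a subring
    of the ambient field F, again with principal ideals, and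
    0 -> L -> F -> F / L -> 0 is an injective resolution of length 1: both F and
    its quotient F / L are divisible L-modules, and over a ring with principal
    ideals divisible modules are injective by Baer's argument
    ([divisible_injective]).  F may be larger than the fraction field of R. *)

Set Implicit Arguments.
Unset Strict Implicit.
Unset Printing Implicit Defensive.

Import GRing.Theory.

Local Open Scope ring_scope.
Local Open Scope classical_set_scope.

(** * Divisible modules over a ring with principal ideals are injective *)

Definition principal_ideals (R : comNzRingType) : Prop :=
  forall I : set R, is_ideal I ->
    exists2 a, I a & forall x, I x -> exists r, x = r * a.

Definition divisible_module (R : comNzRingType) (M : lmodType R) : Prop :=
  forall (a : R) (y : M), a != 0 -> exists z, a *: z = y.

Lemma divisible_image (R : comNzRingType) (M N : lmodType R)
    (p : {linear M -> N}) :
  (forall y, exists x, p x = y) -> divisible_module M -> divisible_module N.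
Proof.
move=> psurj Mdiv a y a0; have [x <-] := psurj y.
by have [z <-] := Mdiv a x a0; exists (p z); rewrite linearZ.
Qed.

Section Baer.
Variables (R : comNzRingType) (B E : lmodType R).
Implicit Types (G : set (B * E)).

(** A partial linear map from B to E, encoded as its graph: a submodule of B * E
    that meets 0 * E trivially.  Membership of (0, 0) is left out so that the
    empty set, which is the union of the empty chain, qualifies too. *)
Definition partial_linear G : Prop :=
  [/\ forall u v, G u -> G v -> G (u + v),
      forall a u, G u -> G (a *: u) &
      forall e, G (0, e) -> e = 0].

Lemma partial_linear_fun G b e e' :
  partial_linear G -> G (b, e) -> G (b, e') -> e = e'.
Proof.
move=> [GD GZ G0] Ge Ge'; apply/eqP; rewrite -subr_eq0; apply/eqP/G0.
have : G (b - 1 *: b, e - 1 *: e').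
  by rewrite -!scaleNr; exact: GD Ge (GZ (-1) _ Ge').
by rewrite !scale1r subrr.
Qed.

Hypotheses (Rpir : principal_ideals R) (Ediv : divisible_module E).

(** The multipliers r for which r b is in the domain of G form an ideal, say
    (a).  Dividing the value of G at a b by a gives a value e1 for b, and
    b |-> e1 is compatible with G at all multiples of b because they are
    controlled by a b. *)
Lemma partial_linear_extend G b : partial_linear G -> G (0, 0) ->
  exists G' : set (B * E),
    [/\ partial_linear G', G `<=` G' & exists e, G' (b, e)].
Proof.
move=> Glin G00; have [GD GZ G0] := Glin.
pose I := [set r : R | exists e, G (r *: b, e)].
have [|a [e0 ae0] Ia] := Rpir (I := I).
  split=> [|x y [e ex] [e' ey]|r x [e ex]].
  - by exists 0; rewrite scale0r.
  - by exists (e + e'); rewrite scalerDl; exact: GD ex ey.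
  - by exists (r *: e); rewrite -scalerA; exact: GZ ex.
(* If a = 0 then e0 is the value of G at 0, so e1 = 0 divides it. *)
have [e1 ae1] : exists e1, a *: e1 = e0.
  have [a0|a0] := eqVneq a 0; last exact: Ediv.
  exists 0.
  by rewrite scaler0; apply/esym/G0; rewrite a0 scale0r in ae0.
exists [set u | exists r, G (u.1 - r *: b, u.2 - r *: e1)].
split; [split|..].
- move=> [x y] [x' y'] [r /= Gu] [r' /= Gv]; exists (r + r') => /=.
  by rewrite !scalerDl !opprD !(addrACA _ _ (- _)); exact: GD Gu Gv.
- move=> s [x y] [r /= Gu]; exists (s * r) => /=.
  by rewrite -!scalerA -!scalerBr; exact: GZ Gu.
- move=> e [r /=]; rewrite sub0r => Gr.
  have Gr' : G (r *: b, r *: e1 - e).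
    rewrite -[r *: b]opprK -(opprB e) -scaleN1r -[- (e - _)]scaleN1r.
    exact: GZ Gr.
  have [|s rE] := Ia r; first by exists (r *: e1 - e).
  have Gr2 : G (r *: b, r *: e1).
    by rewrite rE -!scalerA ae1; exact: GZ ae0.
  have /eqP := partial_linear_fun Glin Gr' Gr2.
  by rewrite eq_sym addrC -subr_eq subrr eq_sym oppr_eq0 => /eqP.
- by move=> [x y] Gxy; exists 0; rewrite /= !scale0r !subr0.
- by exists e1, 1; rewrite /= !scale1r !subrr.
Qed.

End Baer.

(** Baer's argument: by Zorn's lemma the partial map g o i^-1 has a maximal
    partial linear extension, which is total by [partial_linear_extend]. *)
Lemma divisible_injective (R : comNzRingType) (E : lmodType R) :
  principal_ideals R -> divisible_module E -> injective_module E.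
Proof.
move=> Rpir Ediv A B i g iinj.
pose base : set (B * E) := [set u | exists x, u = (i x, g x)].
have base_lin : partial_linear base.
  split=> [_ _ [x ->] [y ->]|a _ [x ->]|e [x [/esym/eqP ix0 ->]]].
  - by exists (x + y); rewrite !linearD.
  - by exists (a *: x); rewrite !linearZ.
  - by move: ix0; rewrite -(linear0 i) => /eqP/iinj ->; rewrite linear0.
(* Containing base is only asked of nonempty sets: the empty union satisfies P. *)
pose P G := partial_linear G /\ (G !=set0 -> base `<=` G).
have [|G [[Glin Gbase] Gmax]] := @Zorn_bigcup _ P.
  move=> C CP Ctot; split; first split.
  - move=> u v [X CX Xu] [Y CY Yv].
    have [XY|YX] := Ctot _ _ CX CY.
      exists Y => //; have [[YD _ _] _] := CP _ CY.
      by apply: YD => //; exact: XY.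
    exists X => //; have [[XD _ _] _] := CP _ CX.
    by apply: XD => //; exact: YX.
  - move=> a u [X CX Xu]; exists X => //.
    by have [[_ XZ _] _] := CP _ CX; exact: XZ.
  - by move=> e [X CX Xe]; have [[_ _ X0] _] := CP _ CX; exact: X0.
  - move=> [u [X CX Xu]]; apply: subset_trans (bigcup_sup CX).
    by have [_] := CP _ CX; apply; exists u.
have G_max G' : partial_linear G' -> base `<=` G' -> G `<=` G' -> G' `<=` G.
  move=> G'lin bG' GG'; apply: contrapT => nG'G.
  by apply: (Gmax G').
have {}Gbase : base `<=` G.
  have [G0|/Gbase //] : G = set0 \/ G !=set0.
    by have [->|/set0P] := eqVneq G set0; [left|right].
  by apply: G_max => //; rewrite G0; exact: sub0set.
have [GD GZ G0] := Glin.
have G00 : G (0, 0) by apply: Gbase; exists 0; rewrite !linear0.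
have Gtot b : exists e, G (b, e).
  have [G' [G'lin GG' [e G'e]]] := partial_linear_extend Rpir Ediv b Glin G00.
  by exists e; apply: G_max G'e => //; exact: subset_trans GG'.
pose h b := projT1 (cid (Gtot b)).
have hP b : G (b, h b) by rewrite /h; case: cid.
have h_lin : linear h.
  move=> a x y; apply: (partial_linear_fun Glin) (hP _) _.
  exact: GD (GZ a _ (hP x)) (hP y).
pose hL := GRing.isLinear.Build R B E _ h h_lin.
pose H : {linear B -> E} := HB.pack h hL.
exists H => x; apply: (partial_linear_fun Glin) (hP _) _.
by apply: Gbase; exists x.
Qed.

(** * Cokernels and resolutions of length one *)

Section Cokernel.
Variables (R : comNzRingType) (A M : lmodType R) (i : {linear A -> M}).

Definition image_pred : {pred M} := fun y => `[< exists x, i x = y >].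

Fact image_pred_submod : submod_closed image_pred.
Proof.
split=> [|a _ _ /asboolP[x <-] /asboolP[y <-]]; apply/asboolP.
  by exists 0; rewrite linear0.
by exists (a *: x + y); rewrite linearP.
Qed.

HB.instance Definition _ :=
  GRing.isSubmodClosed.Build R M image_pred image_pred_submod.

Definition cokernel := Quotient.quot image_pred.

HB.instance Definition _ := GRing.Zmodule.on cokernel.

Definition coker_proj : M -> cokernel := \pi_cokernel%qT.

Lemma coker_projD : {morph coker_proj : x y / x + y}.
Proof. by move=> x y; rewrite /coker_proj raddfD. Qed.

Lemma coker_proj_eq x y : coker_proj x = coker_proj y <-> exists z, i z = x - y.
Proof.
split=> [/eqP|ixy].
  by rewrite /coker_proj -Quotient.idealrBE => /asboolP.
by apply/eqP; rewrite /coker_proj -Quotient.idealrBE; exact/asboolP.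
Qed.

Lemma coker_proj_surj y : exists x, coker_proj x = y.
Proof. by exists (repr y); rewrite /coker_proj reprK. Qed.

(** Scaling goes through an arbitrary representative; [coker_scaleE] says that
    the choice does not matter. *)
Definition coker_scale a (y : cokernel) := coker_proj (a *: repr y).

Lemma coker_scaleE a x : coker_scale a (coker_proj x) = coker_proj (a *: x).
Proof.
apply/coker_proj_eq.
have [|z iz] := (coker_proj_eq (repr (coker_proj x)) x).1.
  by rewrite /coker_proj reprK.
by exists (a *: z); rewrite linearZ /= iz scalerBr.
Qed.

Fact coker_scaleA a b y :
  coker_scale a (coker_scale b y) = coker_scale (a * b) y.
Proof. by have [x <-] := coker_proj_surj y; rewrite !coker_scaleE scalerA. Qed.

Fact coker_scale1 : left_id 1 coker_scale.
Proof.
by move=> y; have [x <-] := coker_proj_surj y; rewrite coker_scaleE scale1r.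
Qed.

Fact coker_scaleDr : right_distributive coker_scale +%R.
Proof.
move=> a y y'; have [x <-] := coker_proj_surj y.
have [x' <-] := coker_proj_surj y'.
by rewrite -coker_projD !coker_scaleE -coker_projD scalerDr.
Qed.

Fact coker_scaleDl y : {morph coker_scale^~ y : a b / a + b}.
Proof.
move=> a b; have [x <-] := coker_proj_surj y.
by rewrite !coker_scaleE -coker_projD scalerDl.
Qed.

HB.instance Definition _ := GRing.Zmodule_isLmodule.Build R cokernel
  coker_scaleA coker_scale1 coker_scaleDr coker_scaleDl.

Fact coker_proj_linear : linear coker_proj.
Proof. by move=> a x y; rewrite coker_projD -coker_scaleE. Qed.

HB.instance Definition _ :=
  GRing.isLinear.Build R M cokernel _ coker_proj coker_proj_linear.

End Cokernel.

Lemma zero_module_injective (R : comNzRingType) : injective_module 'M[R]_0.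
Proof.
by move=> A B i g _; exists \0 => x; rewrite [LHS]flatmx0 [RHS]flatmx0.
Qed.

(** The resolution is M -> E -> coker i -> 0 -> 0 -> ... *)
Lemma injdim_le1 (R : comNzRingType) (M E : lmodType R) (i : {linear M -> E}) :
  injective i -> injective_module E -> injective_module (cokernel i) ->
  injdim_le M 1.
Proof.
move=> iinj Einj Cinj.
pose N (k : nat) : lmodType R :=
  match k with 0 => E | 1 => cokernel i | _ => 'M[R]_0 end.
pose del (k : nat) : {linear N k -> N k.+1} :=
  match k with 0 => @coker_proj R M E i | _ => \0 end.
exists N, i, del; split=> //.
- by case=> [|[|k]] //; exact: zero_module_injective.
- move=> y; split=> [/= y0|[x <-]]; last first.
    rewrite /= -(linear0 (@coker_proj R M E i)); apply/coker_proj_eq.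
    by exists x; rewrite subr0.
  have [|x xy] := (coker_proj_eq i y 0).1; first by rewrite linear0.
  by exists x; rewrite xy subr0.
- case=> [|k] y; split=> // _; first exact: coker_proj_surj.
  by exists 0; rewrite [LHS]flatmx0 [RHS]flatmx0.
- by case=> [|[|k]] // _ y; exact: flatmx0.
Qed.

(** F as an R-module along f.  A copy of F, so that modules along different
    morphisms do not get confused. *)
Definition restricted (R F : comNzRingType) (f : {rmorphism R -> F}) : Type :=
  F.

Section RestrictionOfScalars.
Variables (R F : comNzRingType) (f : {rmorphism R -> F}).
Local Notation restricted := (restricted f).

HB.instance Definition _ := GRing.Zmodule.on restricted.
Definition restricted_scale (a : R) (x : restricted) : restricted := f a * x.

Fact restricted_scaleA a b x :
  restricted_scale a (restricted_scale b x) = restricted_scale (a * b) x.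
Proof. by rewrite /restricted_scale rmorphM mulrA. Qed.

Fact restricted_scale1 : left_id 1 restricted_scale.
Proof. by move=> x; rewrite /restricted_scale rmorph1 mul1r. Qed.

Fact restricted_scaleDr : right_distributive restricted_scale +%R.
Proof. by move=> a x y; rewrite /restricted_scale mulrDr. Qed.

Fact restricted_scaleDl x : {morph restricted_scale^~ x : a b / a + b}.
Proof. by move=> a b; rewrite /restricted_scale rmorphD mulrDl. Qed.

HB.instance Definition _ := GRing.Zmodule_isLmodule.Build R restricted
  restricted_scaleA restricted_scale1 restricted_scaleDr restricted_scaleDl.

Definition into_restricted (a : R^o) : restricted := f a.

Fact into_restricted_linear : linear into_restricted.
Proof. by move=> a x y; rewrite /into_restricted rmorphD rmorphM. Qed.

HB.instance Definition _ :=
  GRing.isLinear.Build R R^o restricted _ into_restricted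
    into_restricted_linear.

End RestrictionOfScalars.

(** F is divisible over L as nonzero elements of L become invertible in F, and
    F / L inherits divisibility; both are therefore injective. *)
Lemma injdim_le1_pid (L : comNzRingType) (F : fieldType)
    (f : {rmorphism L -> F}) :
  injective f -> principal_ideals L -> injdim_le L^o 1.
Proof.
move=> finj Lpir.
have Fdiv : divisible_module (restricted f).
  move=> a y a0; exists ((f a)^-1 * y : F).
  have fa0 : f a != 0.
    by apply: contra_neq a0; rewrite -(rmorph0 f); exact: finj.
  exact: mulVKf.
apply: (@injdim_le1 _ _ _ (into_restricted f)) => //.
  exact: divisible_injective.
apply: divisible_injective => //.
apply: (divisible_image (p := @coker_proj _ _ _ (into_restricted f))) => //.
exact: coker_proj_surj.
Qed.

(** * Principal ideal domains are Gorenstein *)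

(** Every element of an ideal of L is, up to a unit, the image of an element of
    R, so a generator of the preimage of the ideal generates it. *)
Lemma principal_ideals_localization (R L : comNzRingType) (P : set R)
    (f : {rmorphism R -> L}) :
  is_localization_at P f -> principal_ideals R -> principal_ideals L.
Proof.
move=> [funit ffrac _] Rpir I [I0 ID IM].
have [|a Ia aI] := Rpir (fun r => I (f r)).
  split=> [|x y Ix Iy|r x Ix]; first by rewrite rmorph0.
  - by rewrite rmorphD; exact: ID.
  - by rewrite rmorphM; exact: IM.
exists (f a) => // y Iy; have [b [s [Ps yfs]]] := ffrac y.
have [u fsu] := funit s Ps.
have [|r br] := aI b; first by rewrite -yfs mulrC; exact: IM.
by exists (f r * u); rewrite -[y]mulr1 -fsu mulrA yfs br rmorphM mulrAC.
Qed.

(** If s is outside P, maximality gives 1 = p + r s with p in P, and then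
    t = p t + r s t would be in P if s t were. *)
Lemma maximal_ideal_prime (R : comNzRingType) (P : set R) s t :
  maximal_ideal P -> ~ P s -> ~ P t -> ~ P (s * t).
Proof.
move=> [[P0 PD PM] P1 Pmax] Ps Pt Pst.
pose J := [set x : R | exists p r, P p /\ x = p + r * s].
have Jideal : is_ideal J.
  split=> [|_ _ [p [r [Pp ->]]] [q [r' [Pq ->]]]|a _ [p [r [Pp ->]]]].
  - by exists 0, 0; rewrite mul0r addr0.
  - by exists (p + q), (r + r'); rewrite mulrDl addrACA; split=> //; exact: PD.
  - by exists (a * p), (a * r); rewrite mulrDr mulrA; split=> //; exact: PM.
have J1 : J 1.
  apply: contrapT => J1; apply/Ps/(Pmax J) => // [x Px|].
    by exists x, 0; rewrite mul0r addr0.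
  by exists 0, 1; rewrite mul1r add0r.
have [p [r [Pp E]]] := J1; apply: Pt.
rewrite -[t]mul1r E mulrDl -mulrA; apply: PD; last exact: PM.
by rewrite mulrC; exact: PM.
Qed.

Section SubringType.
Variables (F : fieldType) (S : subringClosed F).

Record subring_type : Type := SubringElt {
  subring_val :> F; _ : subring_val \in S }.

HB.instance Definition _ := [isSub for subring_val].
HB.instance Definition _ := [Choice of subring_type by <:].
HB.instance Definition _ := [SubChoice_isSubComNzRing of subring_type by <:].

End SubringType.

(** The fractions a / s of F with s outside P form a subring because P is prime,
    and this subring is the localization of R at P. *)
Lemma localization_in_field (R : comNzRingType) (F : fieldType)
    (f : {rmorphism R -> F}) (P : set R) :
  injective f -> maximal_ideal P ->
  exists (L : comNzRingType) (l : {rmorphism R -> L}) (g : {rmorphism L -> F}),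
    is_localization_at P l /\ injective g.
Proof.
move=> finj Pmax; have [[P0 _ _] P1 _] := Pmax.
have f0 s : ~ P s -> f s != 0.
  move=> Ps; apply/eqP; rewrite -(rmorph0 f) => /finj s0.
  by apply: Ps; rewrite s0.
pose S : {pred F} := fun x => `[< exists a s, ~ P s /\ x = f a / f s >].
have S_closed : subring_closed S.
  split=> [|_ _ /asboolP[a [s [Ps ->]]] /asboolP[b [t [Pt ->]]]
           |_ _ /asboolP[a [s [Ps ->]]] /asboolP[b [t [Pt ->]]]]; apply/asboolP.
  - by exists 1, 1; rewrite rmorph1 divr1.
  - exists (a * t - b * s), (s * t); split; first exact: maximal_ideal_prime.
    by rewrite -mulNr addf_div ?f0 // mulNr rmorphB !rmorphM.
  - exists (a * b), (s * t); split; first exact: maximal_ideal_prime.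
    by rewrite !rmorphM mulf_div.
pose S' := GRing.isSubringClosed.Build F S S_closed.
pose SS : subringClosed F := HB.pack S S'.
pose L : comNzRingType := subring_type SS.
have fS a : f a \in SS by apply/asboolP; exists a, 1; rewrite rmorph1 divr1.
pose l0 a : L := SubringElt (fS a).
have l_add : zmod_morphism l0 by move=> a b; apply/val_inj; rewrite /= rmorphB.
have l_mul : monoid_morphism l0.
  by split=> [|a b]; apply/val_inj; rewrite /= ?rmorph1 ?rmorphM.
pose l : {rmorphism R -> L} := HB.pack l0
  (GRing.isZmodMorphism.Build R L l0 l_add)
  (GRing.isMonoidMorphism.Build R L l0 l_mul).
exists L, l, (\val : {rmorphism L -> F}); split; last exact: val_inj.
split=> [s Ps|y|a].
- have sV : (f s)^-1 \in SS.
    by apply/asboolP; exists 1, s; rewrite rmorph1 div1r.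
  by exists (SubringElt sV); apply/val_inj; rewrite /= mulfV ?f0.
- have /asboolP[a [s [Ps yE]]] := valP y.
  by exists a, s; split=> //; apply/val_inj; rewrite /= yE divfK ?f0.
- move/(congr1 val) => /= fa0; exists 1 => //; rewrite mul1r.
  by apply: finj; rewrite rmorph0.
Qed.

Lemma gorenstein_pid (R : comNzRingType) (F : fieldType)
    (f : {rmorphism R -> F}) :
  injective f -> principal_ideals R -> gorenstein R.
Proof.
move=> finj Rpir; split=> [I Iideal|P Pmax].
  have [a Ia aI] := Rpir I Iideal; exists [:: a].
  apply/seteqP; split=> x.
    by move/aI=> [r ->] J [_ _ JM] aJ; apply/JM/aJ; rewrite /= mem_head.
  by apply=> // _ /= /[!inE] /eqP ->.
have [L [l [g [locl ginj]]]] := localization_in_field finj Pmax.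
exists L, l; split=> //; exists 1%N.
exact: injdim_le1_pid ginj (principal_ideals_localization locl Rpir).
Qed.

(** * Monomial ideals *)

Section IdealSpan.
Variable R : comNzRingType.
Implicit Types (A B : set R).

Lemma sub_ideal_span A : A `<=` ideal_span A.
Proof. by move=> x Ax J _; apply. Qed.

Lemma ideal_span_mono A B : A `<=` B -> ideal_span A `<=` ideal_span B.
Proof. by move=> AB x Ax J Jideal BJ; apply: Ax => // y /AB /BJ. Qed.

End IdealSpan.

Section MonomialIdealSupport.
Variables (K : fieldType) (n : nat).
Implicit Types (p q : {mpoly K[n]}) (m a c : 'X_{1..n}).

Lemma supported_ideal (U : set 'X_{1..n}) :
  (forall m m', U m -> U (m' + m)%MM) ->
  is_ideal [set p : {mpoly K[n]} | {in msupp p, forall m, U m}].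
Proof.
move=> Uup; split=> [m|p q pU qU m /msuppD_le|p q qU m /msuppM_le].
- by rewrite msupp0.
- by rewrite mem_cat => /orP[/pU|/qU].
- by case/allpairsP=> -[m1 m2] /= [_ /qU Um2 ->]; exact: Uup.
Qed.

(** The polynomials all of whose monomials are multiples of elements of A form
    an ideal, which contains the generators. *)
Lemma msupp_monomial_span (A : set 'X_{1..n}) p m :
  ideal_span [set x | exists2 a, A a & x = 'X_[a]] p -> m \in msupp p ->
  exists2 a, A a & (a <= m)%MM.
Proof.
pose U := [set m | exists2 a, A a & (a <= m)%MM].
move/(_ [set q | {in msupp q, forall m, U m}]) => pU; move: m; apply: pU.
  apply: supported_ideal => x y [a Aa ax]; exists a => //.
  exact: lepm_trans ax (lem_addl _ _).
by move=> _ [a Aa ->] x /mem_msuppXP <-; exists a; rewrite ?lepm_refl.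
Qed.

Lemma mdeg_le m m' : (m <= m')%MM -> (mdeg m <= mdeg m')%N.
Proof. by move/mnm_lepP=> le; rewrite !mdegE leq_sum. Qed.

Lemma mnm_le_mdeg_eq m m' : (m <= m')%MM -> (mdeg m' <= mdeg m)%N -> m = m'.
Proof.
move=> le deg; rewrite -(submK le) -[LHS]add0m; congr (_ + _)%MM.
apply/esym/eqP.
rewrite -mdeg_eq0 -(eqn_add2r (mdeg m)) -mdegD submK // add0n.
by rewrite eqn_leq deg mdeg_le.
Qed.

(** In a monomial generating family of (X^c), some X^a divides X^c, while X^c
    divides X^a as X^a lies in (X^c); hence a = c.  So c is in the family, and a
    minimal family has nothing else. *)
Lemma min_mongens_principal c (J : set {mpoly K[n]}) :
  J = @monomial_span K n [:: c] -> min_mongens J = [:: c].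
Proof.
have span_le (w : seq 'X_{1..n}) m :
    @monomial_span K n w 'X_[m] -> exists2 a, a \in w & (a <= m)%MM.
  move=> wm; apply: (@msupp_monomial_span (fun a => a \in w)) wm _.
  by rewrite msuppX mem_head.
have in_span (w : seq 'X_{1..n}) m : m \in w -> @monomial_span K n w 'X_[m].
  by move=> mw; apply: sub_ideal_span; exists m.
have c_in (w : seq 'X_{1..n}) :
    @monomial_span K n w = @monomial_span K n [:: c] -> c \in w.
  move=> wc; have [|a aw ac] := span_le w c.
    by rewrite wc; apply: in_span; exact: mem_head.
  have [|b] := span_le [:: c] a; first by rewrite -wc; exact: in_span.
  by rewrite inE => /eqP -> ca; rewrite -(mnm_le_mdeg_eq ac (mdeg_le ca)).
move=> ->; apply: xget_unique => [|w [w_uniq wJ wmin]].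
  by split=> // w' _ w'J m; rewrite inE => /eqP ->; exact: c_in.
have cw := c_in w wJ.
have wc : {subset w <= [:: c]}.
  by apply: wmin => // m; rewrite inE => /eqP ->.
apply/perm_small_eq => //; apply: uniq_perm => // m.
by apply/idP/idP => [/wc //|]; rewrite inE => /eqP ->.
Qed.

End MonomialIdealSupport.

(** * Powers of the edge ideal *)

Section EdgeIdealPowers.
Variables (K : fieldType) (n : nat) (e : rel 'I_n).
Local Notation I := (edge_ideal e : set {mpoly K[n]}).

Lemma msupp_edge_pow r p m :
  ideal_pow I r p -> m \in msupp p -> (2 * r <= mdeg m)%N.
Proof.
have deg_ideal d : is_ideal [set p : {mpoly K[n]} |
    {in msupp p, forall m, (d <= mdeg m)%N}].
  apply: (@supported_ideal K n (fun m => (d <= mdeg m)%N)) => x y.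
  by rewrite mdegD => /leq_trans; apply; exact: leq_addl.
move/(_ _ (deg_ideal (2 * r)%N)) => pU; move: m; apply: pU.
move=> _ [f [If ->]].
have -> : (2 * r = \sum_(i < r) 2)%N by rewrite sum_nat_const card_ord mulnC.
apply: (big_ind2 (fun d (q : {mpoly K[n]}) =>
  {in msupp q, forall m, (d <= mdeg m)%N})) => [//|d q d' q' dq dq' m|i _].
  case/msuppM_le/allpairsP=> -[m1 m2] /= [/dq ? /dq' ? ->].
  by rewrite mdegD leq_add.
apply: (If i _ (deg_ideal 2%N)) => _ [j [k [_ ->]]] m.
by rewrite -mpolyXD => /mem_msuppXP <-; rewrite mdegD !mdeg1.
Qed.

Variable s : 'I_n -> 'I_n.
Hypothesis es : forall i, e i (s i).

Let c : 'X_{1..n} := (\sum_(i < n) (U_(i) + U_(s i)))%MM.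

Lemma mdeg_matched : mdeg c = (2 * n)%N.
Proof.
rewrite mdeg_sum (eq_bigr (fun=> 2%N)) => [|i _].
  by rewrite sum_nat_const card_ord mulnC.
by rewrite mdegD !mdeg1.
Qed.

Lemma matched_in_pow : ideal_pow I n 'X_[c].
Proof.
apply: sub_ideal_span; exists (fun i => 'X_i * 'X_(s i)); split.
  by move=> i; apply: sub_ideal_span; exists i, (s i).
rewrite (big_morph _ (@mpolyXD n K) (@mpolyX0 n K)).
by apply: eq_bigr => i _; rewrite mpolyXD.
Qed.

(** A bounded monomial of I^n has degree at least 2n = deg c, so it equals
    X^c. *)
Lemma matched_bounded_part :
  bounded_part c (ideal_pow I n) = @monomial_span K n [:: c].
Proof.
congr (ideal_span _); apply/seteqP; split=> [p [m [Im mc ->]]|_ [m mc ->]].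
  exists m => //; rewrite inE; apply/eqP/mnm_le_mdeg_eq => //.
  by rewrite mdeg_matched; apply: msupp_edge_pow Im _; rewrite msuppX mem_head.
move: mc; rewrite inE => /eqP ->; exists c; split=> //.
  exact: matched_in_pow.
exact: lepm_refl.
Qed.

(** A nonzero bounded part of I^r yields a monomial of I^r dividing X^c, and
    degrees give 2r <= 2n. *)
Lemma matched_delta : delta c I = n.
Proof.
have delta_n : is_delta c I n.
  split=> [|r [p Ip p0]].
    exists 'X_[c]; last by rewrite -msupp_eq0 msuppX.
    rewrite matched_bounded_part; apply: sub_ideal_span.
    by exists c; rewrite ?mem_head.
  have [m mp] : exists m, m \in msupp p.
    by exists (mlead p); exact: mlead_supp.
  have [|a [Ia ac] _] := @msupp_monomial_span K n
      (fun a => ideal_pow I r 'X_[a] /\ (a <= c)%MM) p m _ mp.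
    by apply: ideal_span_mono Ip => _ [a [Ia ac ->]]; exists a.
  rewrite -(leq_pmul2l (isT : (0 < 2)%N)) -mdeg_matched.
  apply: leq_trans (mdeg_le ac); apply: msupp_edge_pow Ia _.
  by rewrite msuppX mem_head.
apply: xget_unique => // q [nz_q q_max]; case: delta_n => nz_n n_max.
by apply/eqP; rewrite eqn_leq n_max // q_max.
Qed.

Lemma matched_min_mongens :
  min_mongens (bounded_part c (ideal_pow I (delta c I))) = [:: c].
Proof.
by rewrite matched_delta; exact/min_mongens_principal/matched_bounded_part.
Qed.

End EdgeIdealPowers.

(** * Algebras generated by one monomial *)

(** Euclidean division: a nonzero element of least degree generates. *)
Lemma principal_ideals_poly (K : fieldType) : principal_ideals {poly K}.
Proof.
move=> I [I0 ID IM].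
have [[p0 [Ip0 p0_neq0]]|I_zero] := pselect (exists p, I p /\ p != 0);
  last first.
  exists 0 => // p Ip; exists 0; rewrite mul0r; apply: contrapT => /eqP p0.
  by apply: I_zero; exists p.
pose P k := `[< exists p, [/\ I p, p != 0 & size p = k] >].
have exP : exists k, P k by exists (size p0); apply/asboolP; exists p0.
case: (ex_minnP exP) => k /asboolP[a [Ia a0 ak] kmin]; exists a => // p Ip.
exists (p %/ a); rewrite [LHS](divp_eq p a); apply/eqP.
rewrite -subr_eq0 addrC addKr; apply: contraT => r0.
have : (size (p %% a)%R < size a)%N by rewrite ltn_modp.
rewrite ltnNge ak kmin //; apply/asboolP; exists (p %% a); split=> //.
have -> : p %% a = p + - (p %/ a) * a.
  by rewrite mulNr {2}(divp_eq p a) addrAC subrr add0r.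
by apply: ID => //; exact: IM.
Qed.

Lemma principal_ideals_image (R S : comNzRingType) (f : {rmorphism R -> S}) :
  (forall y, exists x, f x = y) -> principal_ideals R -> principal_ideals S.
Proof.
move=> fsurj Rpir I [I0 ID IM].
have [|a Ia aI] := Rpir (fun x => I (f x)).
  split=> [|x y Ix Iy|r x Ix]; first by rewrite rmorph0.
  - by rewrite rmorphD; exact: ID.
  - by rewrite rmorphM; exact: IM.
exists (f a) => // y; have [x <-] := fsurj y.
by move=> /aI[r ->]; exists (f r); rewrite rmorphM.
Qed.

Section OneMonomial.
Variables (K : fieldType) (n : nat) (c : 'X_{1..n}).
Local Notation R := (monomial_ring K [:: c]).

Fact monomial_subalgC (k : K) : k%:MP \in @monomial_subalg K n [:: c].
Proof. by apply/asboolP; exists k%:MP; rewrite comp_mpolyC. Qed.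

Fact monomial_subalgX : 'X_[c] \in @monomial_subalg K n [:: c].
Proof. by apply/asboolP; exists 'X_ord0; rewrite comp_mpolyXU. Qed.

Definition monomial_const (k : K) : R := MonomialRing (monomial_subalgC k).

Fact monomial_const_zmod : zmod_morphism monomial_const.
Proof. by move=> a b; apply/val_inj; rewrite /= rmorphB. Qed.

Fact monomial_const_monoid : monoid_morphism monomial_const.
Proof. by split=> [|a b]; apply/val_inj; rewrite /= ?rmorph1 ?rmorphM. Qed.

HB.instance Definition _ :=
  GRing.isZmodMorphism.Build K R monomial_const monomial_const_zmod.
HB.instance Definition _ :=
  GRing.isMonoidMorphism.Build K R monomial_const monomial_const_monoid.

Let Xc : R := MonomialRing monomial_subalgX.

Let Xc_comm : commr_rmorph monomial_const Xc.
Proof. by move=> k; exact: mulrC. Qed.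

(** The evaluation t |-> X^c from K[t].  It is onto for every c, and has a
    kernel exactly when c = 0, where it evaluates at 1. *)
Definition monomial_horner : {rmorphism {poly K} -> R} := horner_morph Xc_comm.

Lemma monomial_horner_surj y : exists p, monomial_horner p = y.
Proof.
have /asboolP[P yE] := valP y.
exists (\sum_(m <- msupp P) P@_m *: 'X^(m ord0)); apply/val_inj.
rewrite [RHS]yE comp_mpolyE !rmorph_sum /=; apply: eq_bigr => m _.
rewrite -mul_polyC !rmorphM /= horner_morphC !rmorphXn /= horner_morphX.
rewrite mul_mpolyC big_ord1 (tnth_nth 0); congr (_ *: _).
exact: (rmorphXn (\val : {rmorphism R -> {mpoly K[n]}})).
Qed.

Lemma principal_ideals_one_monomial : principal_ideals R.
Proof.
exact: principal_ideals_image monomial_horner_surj (@principal_ideals_poly K).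
Qed.

Lemma gorenstein_one_monomial : gorenstein R.
Proof.
pose f : {rmorphism R -> {fraction {mpoly K[n]}}} :=
  @tofrac {mpoly K[n]} \o \val.
apply: (@gorenstein_pid _ _ f _ principal_ideals_one_monomial) => x y /eqP.
by rewrite /= tofrac_eq => /eqP/val_inj.
Qed.

End OneMonomial.

Theorem theorem2p1 (K : fieldType) (n : nat) (e : rel 'I_n)
    (Ge : simple_graph e) (Gni : no_isolated_vertex e) :
  exists c : 'X_{1..n}, (forall i, 0 < c i)%N /\ gorenstein (toric_ring K c e).
Proof.
have [s es] : exists s : 'I_n -> 'I_n, forall i, e i (s i).
  by exists (fun i => projT1 (cid (Gni i))) => i; case: cid.
exists (\sum_(i < n) (U_(i) + U_(s i)))%MM; split=> [i|].
  by rewrite mnm_sumE (bigD1 i) //= mnmDE mnm1E eqxx.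
by rewrite /toric_ring matched_min_mongens //; exact: gorenstein_one_monomial.
Qed.
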